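(* Suppose that $G$ is a maximal tower of computable sets. Then there is no computation procedure with oracle $\emptyset'$ that computes, from input $n$, a characteristic index for $G_n$. (That is, there is no $\emptyset'$-computable function $r\colon\omega\to\omega$ such that $\varphi_{r(n)}$ is the characteristic function of $G_n$ for every $n$.)
   Context: For sets $A,B\subseteq\omega$, $A\subseteq^* B$ means $A\setminus B$ is finite. $(\varphi_e)_{e\in\omega}$ is a standard effective listing of the partial computable functions; a characteristic index for a set $M$ is a number $e$ such that $\varphi_e$ is the characteristic function of $M$. With $\langle\cdot,\cdot\rangle$ the usual computable Cantor pairing function on $\omega$, a set $X\subseteq\omega$ encodes the sequence $(X_n)_{n\in\omega}$ of its columns $X_n=\{u:\langle u,n\rangle\in X\}$. A set $G$ is a tower of computable sets if each $G_n$ is computable, $G_0=\omega$, and for each $n$, $G_{n+1}\subseteq^* G_n$ and $G_n\setminus G_{n+1}$ is infinite. It is maximal if for each infinite computable set $R$ there is $n$ such that $R\setminus G_n$ is infinite. *)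

(* Defs.v *)
From Stdlib Require Cantor.
From mathcomp Require Import all_boot.
From mathcomp Require Import zify.
From mathcomp Require Import boolp classical_sets functions cardinality.

Set Implicit Arguments.
Unset Strict Implicit.
Unset Printing Implicit Defensive.

Local Open Scope classical_set_scope.

Definition npair (x y : nat) : nat := Cantor.to_nat (x, y).

(** * Partial computable functions, with an oracle *)

(** Unary algorithms in the style of Kleene; several arguments are passed as
    one number by means of [npair]. *)
Inductive code : Type :=
| CZero
| CSucc
| CFst
| CSnd
| COracle
| CPair of code & code
| CComp of code & code
| CPrec of code & code
| CMu of code.

(** A partial function is represented by its graph. *)
Definition pfun : Type := nat -> nat -> Prop.

Definition computes (psi : pfun) (f : nat -> nat) : Prop :=
  forall n v, psi n v <-> v = f n.

Definition charfun (M : set nat) (u : nat) : nat := nat_of_bool (u \in M).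

Definition pf_pair (f g : pfun) : pfun :=
  fun n v => exists x y, [/\ f n x, g n y & v = npair x y].

Definition pf_comp (f g : pfun) : pfun := fun n v => exists2 w, g n w & f w v.

Fixpoint pf_rec (f g : pfun) (a k v : nat) : Prop :=
  if k is j.+1
  then exists2 w, pf_rec f g a j w & g (npair a (npair j w)) v
  else f a v.

Definition pf_prec (f g : pfun) : pfun :=
  fun n v => pf_rec f g (Cantor.of_nat n).1 (Cantor.of_nat n).2 v.

(** The search diverges if [f] is undefined below the first zero. *)
Definition pf_mu (f : pfun) : pfun :=
  fun n v => f (npair n v) 0 /\
             forall k, k < v -> exists w, f (npair n k) w.+1.

Fixpoint eval (X : set nat) (c : code) : pfun :=
  match c with
  | CZero => fun _ v => v = 0
  | CSucc => fun n v => v = n.+1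
  | CFst => fun n v => v = (Cantor.of_nat n).1
  | CSnd => fun n v => v = (Cantor.of_nat n).2
  | COracle => fun n v => v = charfun X n
  | CPair f g => pf_pair (eval X f) (eval X g)
  | CComp f g => pf_comp (eval X f) (eval X g)
  | CPrec f g => pf_prec (eval X f) (eval X g)
  | CMu f => pf_mu (eval X f)
  end.

Fixpoint encode (c : code) : nat :=
  match c with
  | CZero => 0
  | CSucc => 1
  | CFst => 2
  | CSnd => 3
  | COracle => 4
  | CPair f g => 4 * npair (encode f) (encode g) + 5
  | CComp f g => 4 * npair (encode f) (encode g) + 6
  | CPrec f g => 4 * npair (encode f) (encode g) + 7
  | CMu f => 4 * encode f + 8
  end.

Lemma npair_inj x y x' y' : npair x y = npair x' y' -> x = x' /\ y = y'.
Proof. by move/Cantor.to_nat_inj => [-> ->]. Qed.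

Lemma encode_inj : injective encode.
Proof.
elim=> [|||||f IHf g IHg|f IHf g IHg|f IHf g IHg|f IHf];
  case=> [|||||f' g'|f' g'|f' g'|f'] //= E; try (exfalso; lia).
- have /npair_inj[/IHf -> /IHg ->] //: npair (encode f) (encode g)
    = npair (encode f') (encode g') by lia.
- have /npair_inj[/IHf -> /IHg ->] //: npair (encode f) (encode g)
    = npair (encode f') (encode g') by lia.
- have /npair_inj[/IHf -> /IHg ->] //: npair (encode f) (encode g)
    = npair (encode f') (encode g') by lia.
- by have /IHf -> : encode f = encode f' by lia.
Qed.

Lemma encode_surj e : exists c, encode c = e.
Proof.
elim/ltn_ind: e => e IH.
have [e5|e5] := ltnP e 5.
  case: e e5 {IH} => [|[|[|[|[|e]]]]] // _;
  [by exists CZero | by exists CSucc | by exists CFst | by exists CSnd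
  | by exists COracle].
pose q := (e - 5) %/ 4.
have qlt : q < e by rewrite /q; lia.
have [x [y qE]] : exists x y, q = npair x y.
  by exists (Cantor.of_nat q).1, (Cantor.of_nat q).2;
     rewrite /npair -surjective_pairing Cantor.cancel_to_of.
have := Cantor.to_nat_non_decreasing x y; rewrite -/(npair x y) -qE => xyq.
have [f fE] : exists c, encode c = x by apply: IH; lia.
have [g gE] : exists c, encode c = y by apply: IH; lia.
have [h hE] : exists c, encode c = q by apply: IH.
have : e = 4 * q + 5 \/ e = 4 * q + 6 \/ e = 4 * q + 7 \/ e = 4 * q + 8.
  by rewrite /q; lia.
move=> [->|[->|[->|->]]].
- by exists (CPair f g); rewrite /= fE gE qE.
- by exists (CComp f g); rewrite /= fE gE qE.
- by exists (CPrec f g); rewrite /= fE gE qE.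
- by exists (CMu h); rewrite /= hE.
Qed.

(** [Phi X e] is the [e]-th partial function computable with oracle [X]. As
    [encode] is a computable bijection between codes and numbers, exactly one
    code contributes. *)
Definition Phi (X : set nat) (e : nat) : pfun :=
  fun n v => exists2 c, encode c = e & eval X c n v.

(** Oracle calls to the empty set return 0, so this is a standard listing of
    the partial computable functions. *)
Definition phi : nat -> pfun := Phi set0.

Definition jump (X : set nat) : set nat := [set e | exists v, Phi X e e v].

Definition computable_in (X : set nat) (f : nat -> nat) : Prop :=
  exists e, computes (Phi X e) f.

(** * Towers of computable sets *)

Definition char_index (e : nat) (M : set nat) : Prop :=
  computes (phi e) (charfun M).

Definition computable_set (M : set nat) : Prop := exists e, char_index e M.

Definition almost_subset (A B : set nat) : Prop := finite_set (A `\` B).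

Definition column (X : set nat) (n : nat) : set nat := [set u | X (npair u n)].

Definition tower (G : set nat) : Prop :=
  [/\ forall n, computable_set (column G n),
      column G 0 = setT
    & forall n, almost_subset (column G n.+1) (column G n) /\
                infinite_set (column G n `\` column G n.+1)].

Definition maximal_tower (G : set nat) : Prop :=
  tower G /\
  forall R : set nat, infinite_set R -> computable_set R ->
    exists n, infinite_set (R `\` column G n).

(* Main.v *)
Require Import Defs.
From mathcomp Require Import all_boot.
From mathcomp Require Import zify.
From mathcomp Require Import boolp classical_sets functions cardinality filter.

Local Open Scope classical_set_scope.

(** A uniform procedure for the levels of a tower lets a computable set
    diagonalize past all of them. If [r] is computable from the halting problem,
    then [r n] is the limit over [t] of a computable [h n t] ([limit_lemma]).
    Choose numbers [x 0 < x 1 < ...] as follows: given the earlier ones, search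
    for a larger [x s] and a stage [t >= s] such that, for each [i <= s], the
    program with the guessed index [h i t], run for [t] steps on [x s], has
    answered 1.

    The search succeeds although the guesses may be wrong: the intersection of
    the first [s + 1] levels is infinite ([tower_infinite_meet]), and for an
    element of it every sufficiently large [t] is a correct stage. So the set
    [R] of all [x s] is infinite, and it is computable since it is enumerated in
    increasing order. Fix [n]. As soon as [s >= n] has passed the stage from
    which [h n t] equals [r n], the answer 1 comes from the true characteristic
    function, hence [x s] lies in the [n]-th level. So [R] is almost contained in
    every level ([computable_pseudointersection]), against maximality.

    The search simulates programs whose indices are themselves computed, which
    takes a universal program. It is obtained from an abstract machine with an
    explicit stack of pending operations: one machine step is a case distinction
    on numbers, so iterating it is a primitive recursion ([run],
    [run_sound], [run_complete], [computable_run]). *)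

(** * Closure properties of the functions computable in an oracle *)

Definition unpair1 (n : nat) : nat := (Cantor.of_nat n).1.

Definition unpair2 (n : nat) : nat := (Cantor.of_nat n).2.

Lemma npairK1 x y : unpair1 (npair x y) = x.
Proof. by rewrite /unpair1 /npair Cantor.cancel_of_to. Qed.

Lemma npairK2 x y : unpair2 (npair x y) = y.
Proof. by rewrite /unpair2 /npair Cantor.cancel_of_to. Qed.

Lemma unpairK n : npair (unpair1 n) (unpair2 n) = n.
Proof. by rewrite /npair -surjective_pairing Cantor.cancel_to_of. Qed.

Definition npairK := (npairK1, npairK2).

Lemma Phi_encode X c n v : Phi X (encode c) n v <-> eval X c n v.
Proof.
by split=> [[c' /encode_inj->]|] //; exists c.
Qed.

Lemma computable_inP X f : computable_in X f <-> exists c, computes (eval X c) f.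
Proof.
split=> [[e ef]|[c cf]].
  have [c ce] := encode_surj e; exists c => n v.
  by rewrite -Phi_encode ce.
by exists (encode c) => n v; rewrite Phi_encode.
Qed.

Definition computable2_in X (h : nat -> nat -> nat) : Prop :=
  computable_in X (fun p => h (unpair1 p) (unpair2 p)).

Lemma computable_const X k : computable_in X (fun=> k).
Proof.
apply/computable_inP; elim: k => [|k [c ck]]; first by exists CZero.
exists (CComp CSucc c) => n v; split=> [[w /ck-> ->]|->] //.
by exists k => //; apply/ck.
Qed.

Lemma computable_comp X f g :
  computable_in X f -> computable_in X g -> computable_in X (fun n => f (g n)).
Proof.
move=> /computable_inP[c cf] /computable_inP[d dg].
apply/computable_inP; exists (CComp c d) => n v.
split=> [[w /dg-> /cf->]|->] //.
by exists (g n); [apply/dg|apply/cf].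
Qed.

Lemma computable_succ X f : computable_in X f -> computable_in X (fun n => (f n).+1).
Proof. by apply: computable_comp; apply/computable_inP; exists CSucc. Qed.

Lemma computable_unpair1 X f :
  computable_in X f -> computable_in X (fun n => unpair1 (f n)).
Proof. by apply: computable_comp; apply/computable_inP; exists CFst. Qed.

Lemma computable_unpair2 X f :
  computable_in X f -> computable_in X (fun n => unpair2 (f n)).
Proof. by apply: computable_comp; apply/computable_inP; exists CSnd. Qed.

Lemma computable_charfun X f :
  computable_in X f -> computable_in X (fun n => charfun X (f n)).
Proof. by apply: computable_comp; apply/computable_inP; exists COracle. Qed.

Lemma computable_npair X f g :
  computable_in X f -> computable_in X g ->
  computable_in X (fun n => npair (f n) (g n)).
Proof.
move=> /computable_inP[c cf] /computable_inP[d dg].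
apply/computable_inP; exists (CPair c d) => n v.
split=> [[x [y [/cf-> /dg-> ->]]]|->] //.
by exists (f n), (g n); split; [apply/cf|apply/dg|].
Qed.

Lemma computable_id X : computable_in X (fun n => n).
Proof.
apply/computable_inP; exists (CPair CFst CSnd) => n v.
split=> [[x [y [-> -> ->]]]|->]; first exact: unpairK.
by exists (unpair1 n), (unpair2 n); rewrite unpairK.
Qed.

Lemma computable2_comp X h f g :
  computable2_in X h -> computable_in X f -> computable_in X g ->
  computable_in X (fun n => h (f n) (g n)).
Proof.
move=> hh hf hg.
have := computable_comp X _ _ hh (computable_npair X _ _ hf hg).
by under eq_fun do rewrite !npairK.
Qed.

(** Primitive recursion, in which the start value, the step and the number of
    steps may all depend on the input [n]. *)
Lemma computable_iteri X b g k :
  computable_in X b ->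
  computable_in X
    (fun p => g (unpair1 p) (unpair1 (unpair2 p)) (unpair2 (unpair2 p))) ->
  computable_in X k ->
  computable_in X (fun n => iteri (k n) (g n) (b n)).
Proof.
move=> /computable_inP[cb bP] /computable_inP[cg gP] hk.
pose rec p := iteri (unpair2 p) (g (unpair1 p)) (b (unpair1 p)).
(* [CPrec] expects the parameter and the counter as one packed input. *)
suff hrec : computable_in X rec.
  have := computable_comp X _ _ hrec (computable_npair X _ _ (computable_id X) hk).
  by rewrite /rec; under eq_fun do rewrite !npairK.
apply/computable_inP; exists (CPrec cb cg) => p v.
rewrite /= /pf_prec -/(unpair1 p) -/(unpair2 p) /rec.
move: (unpair1 p) (unpair2 p) => a j.
elim: j v => [|j IH] v /=; first exact: bP.
split=> [[w /IH-> /gP]|->]; first by rewrite !npairK.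
by exists (iteri j (g a) (b a)); [apply/IH|apply/gP; rewrite !npairK].
Qed.

Lemma computable_iter X b g k :
  computable_in X b -> computable2_in X g -> computable_in X k ->
  computable_in X (fun n => iter (k n) (g n) (b n)).
Proof.
move=> hb hg hk.
suff -> : (fun n => iter (k n) (g n) (b n)) =
          (fun n => iteri (k n) (fun _ => g n) (b n)).
  apply: (computable_iteri X b (fun n _ => g n)) => //.
  apply: (computable2_comp X g unpair1) => //.
    exact/computable_unpair1/computable_id.
  exact/computable_unpair2/computable_unpair2/computable_id.
by apply/funext => n; elim: (k n) => //= j ->.
Qed.

Lemma computable_pred X f : computable_in X f -> computable_in X (fun n => (f n).-1).
Proof.
apply: (@computable_comp X predn).
(* The predecessor reads off the counter of a recursion that ignores its value. *)
have -> : predn = fun n => iteri n (fun j _ => j) 0 by apply/funext => -[].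
apply: (computable_iteri X (fun=> 0) (fun _ j _ => j)).
- exact: computable_const.
- exact/computable_unpair1/computable_unpair2/computable_id.
- exact: computable_id.
Qed.

Lemma computable_add X f g :
  computable_in X f -> computable_in X g -> computable_in X (fun n => f n + g n).
Proof.
move=> hf hg; under eq_fun do rewrite -iter_succn.
apply: (computable_iter X f (fun=> succn)) => //.
exact/computable_succ/computable_unpair2/computable_id.
Qed.

Lemma computable_sub X f g :
  computable_in X f -> computable_in X g -> computable_in X (fun n => f n - g n).
Proof.
move=> hf hg; under eq_fun do rewrite -iter_predn.
apply: (computable_iter X f (fun=> predn)) => //.
exact/computable_pred/computable_unpair2/computable_id.
Qed.

Lemma computable_ifeq X a b f g :
  computable_in X a -> computable_in X b ->
  computable_in X f -> computable_in X g ->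
  computable_in X (fun n => if a n == b n then f n else g n).
Proof.
move=> ha hb hf hg.
have -> : (fun n => if a n == b n then f n else g n) =
  fun n => iter ((a n - b n) + (b n - a n)) (fun=> g n) (f n).
  apply/funext => n; have [->|ne] := eqVneq (a n) (b n); first by rewrite subnn.
  (* Any positive number of rounds of the constant step [g n] yields [g n]. *)
  have : a n - b n + (b n - a n) != 0 by lia.
  by case: (_ + _).
apply: (computable_iter X f (fun n _ => g n)) => //.
  exact/(computable_comp X g)/computable_unpair1/computable_id.
by apply: computable_add; apply: computable_sub.
Qed.

(** Decomposes the body of the function by the closure lemmas. Matching a body
    can contract it to a bare [unpair1], [unpair2] or [succn], hence the clauses
    for these. *)
Ltac computable :=
  rewrite /computable2_in;
  repeat match goal with
  | H : ?P |- ?P => exact: H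
  | |- computable_in _ (fun _ => ?k) => exact: computable_const
  | |- computable_in _ (fun n => n) => exact: computable_id
  | |- computable_in _ (fun n => npair (@?f n) (@?g n)) =>
      apply: (computable_npair _ f g)
  | |- computable_in _ unpair1 => exact: computable_unpair1 (computable_id _)
  | |- computable_in _ unpair2 => exact: computable_unpair2 (computable_id _)
  | |- computable_in _ succn => exact: computable_succ (computable_id _)
  | |- computable_in _ (fun n => unpair1 (@?f n)) => apply: (computable_unpair1 _ f)
  | |- computable_in _ (fun n => unpair2 (@?f n)) => apply: (computable_unpair2 _ f)
  | |- computable_in _ (fun n => charfun _ (@?f n)) =>
      apply: (computable_charfun _ f)
  | |- computable_in _ (fun n => (@?f n).+1) => apply: (computable_succ _ f)
  | |- computable_in _ (fun n => (@?f n).-1) => apply: (computable_pred _ f)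
  | |- computable_in _ (fun n => @?f n + @?g n) => apply: (computable_add _ f g)
  | |- computable_in _ (fun n => @?f n - @?g n) => apply: (computable_sub _ f g)
  | |- computable_in _ (fun _ => if _ then _ else _) => apply: computable_ifeq
  | |- computable_in _ (fun n => iteri (@?k n) (@?g n) (@?b n)) =>
      apply: (computable_iteri _ b g k)
  | |- computable_in _ (fun n => iter (@?k n) (@?g n) (@?b n)) =>
      apply: (computable_iter _ b g k); rewrite /computable2_in
  | H : computable2_in _ ?h |- computable_in _ (fun n => ?h (@?f n) (@?g n)) =>
      apply: (computable2_comp _ h f g H)
  | H : computable_in _ ?h |- computable_in _ (fun n => ?h (@?f n)) =>
      apply: (computable_comp _ h f H)
  end.

(** Counting up to [n] while keeping the quotient and the remainder as a pair
    gives division by 4, the number of composite constructors of [code]. *)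
Lemma computable_divmod4 X f :
  computable_in X f ->
  computable_in X (fun n => f n %/ 4) /\ computable_in X (fun n => f n %% 4).
Proof.
move=> hf.
pose next w := if unpair2 w == 3 then npair (unpair1 w).+1 0
               else npair (unpair1 w) (unpair2 w).+1.
pose dm n := iter n next (npair 0 0).
have dmE n : dm n = npair (n %/ 4) (n %% 4).
  elim: n => [|n IH] //; rewrite /dm iterS -/(dm n) IH /next !npairK.
  by case: eqP => E; congr npair; lia.
have hdm : computable_in X dm.
  rewrite /dm; apply: (computable_iter X (fun=> npair 0 0) (fun=> next)).
  - computable.
  - rewrite /next; computable.
  - computable.
have hdmf := computable_comp X _ _ hdm hf.
have := (computable_unpair1 X _ hdmf, computable_unpair2 X _ hdmf).
by under eq_fun do rewrite dmE npairK1; case=> h1;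
   under eq_fun do rewrite dmE npairK2.
Qed.

Lemma computable_div4 X f : computable_in X f -> computable_in X (fun n => f n %/ 4).
Proof. by move/computable_divmod4 => []. Qed.

Lemma computable_mod4 X f : computable_in X f -> computable_in X (fun n => f n %% 4).
Proof. by move/computable_divmod4 => []. Qed.

Lemma computable_search X g :
  computable2_in X g -> (forall n, exists k, g n k = 0) ->
  exists2 m, computable_in X m & forall n, g n (m n) = 0.
Proof.
move=> /computable_inP[c cg] g0.
have g0' n : exists k, g n k == 0 by have [k <-] := g0 n; exists k.
exists (fun n => ex_minn (g0' n)); last first.
  by move=> n; case: ex_minnP => k /eqP.
apply/computable_inP; exists (CMu c) => n v; case: ex_minnP => m /eqP gm mmin.
split=> [[/cg]|->].
  rewrite !npairK => gv vmin; apply/eqP; rewrite eqn_leq [m <= v]mmin ?gv //.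
  rewrite andbT leqNgt; apply/negP => /vmin[w /cg].
  by rewrite !npairK gm.
split=> [|k km]; first by apply/cg; rewrite !npairK.
exists (g n k).-1; apply/cg; rewrite !npairK prednK // lt0n.
by apply/negP => /mmin; rewrite leqNgt km.
Qed.

(** * A universal machine *)

(** A pending operation, waiting for the value of the subprogram in progress.
    [FRec g p] holds the parameter and the counter of the recursion in [p];
    [FMu f p] holds the input and the current candidate of the search in [p]. *)
Inductive frame : Type :=
| FPair1 of code & nat
| FPair2 of nat
| FComp of code
| FRec of code & nat
| FMu of code & nat.

Inductive config : Type :=
| Eval of code & nat & seq frame
| Ret of nat & seq frame.

Definition step (X : set nat) (s : config) : config :=
  match s with
  | Eval c n K =>
    match c with
    | CZero => Ret 0 K
    | CSucc => Ret n.+1 K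
    | CFst => Ret (unpair1 n) K
    | CSnd => Ret (unpair2 n) K
    | COracle => Ret (charfun X n) K
    | CPair f g => Eval f n (FPair1 g n :: K)
    | CComp f g => Eval g n (FComp f :: K)
    | CPrec f g =>
      if unpair2 n is j.+1
      then Eval c (npair (unpair1 n) j) (FRec g (npair (unpair1 n) j) :: K)
      else Eval f (unpair1 n) K
    | CMu f => Eval f (npair n 0) (FMu f (npair n 0) :: K)
    end
  | Ret v (FPair1 g n :: K) => Eval g n (FPair2 v :: K)
  | Ret v (FPair2 x :: K) => Ret (npair x v) K
  | Ret v (FComp f :: K) => Eval f v K
  | Ret v (FRec g p :: K) => Eval g (npair (unpair1 p) (npair (unpair2 p) v)) K
  | Ret v (FMu f p :: K) =>
    if v is 0 then Ret (unpair2 p) K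
    else let p' := npair (unpair1 p) (unpair2 p).+1 in Eval f p' (FMu f p' :: K)
  | Ret v [::] => s
  end.

Definition reach X s s' := exists t, iter t (step X) s = s'.

Lemma reach_trans X s2 s1 s3 : reach X s1 s2 -> reach X s2 s3 -> reach X s1 s3.
Proof. by move=> [t <-] [t' <-]; exists (t' + t); rewrite iterD. Qed.

Lemma reach_step X s s' : reach X (step X s) s' -> reach X s s'.
Proof. by move=> [t <-]; exists t.+1; rewrite iterSr. Qed.

Lemma reach_refl X s : reach X s s.
Proof. by exists 0. Qed.

(** The stack below a program is untouched until the program returns, so the
    induction on the program can be done for every stack [K]. *)
Lemma eval_reach X c n v K : eval X c n v -> reach X (Eval c n K) (Ret v K).
Proof.
elim: c n v K => [|||||f IHf g IHg|f IHf g IHg|f IHf g IHg|f IHf] n v K /=;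
  try by move=> ->; exists 1.
- move=> [x [y [fx gy ->]]]; apply/reach_step.
  apply: reach_trans (IHf _ _ _ fx) _; apply/reach_step.
  by apply: reach_trans (IHg _ _ _ gy) _; apply/reach_step/reach_refl.
- move=> [w gw fv]; apply/reach_step.
  by apply: reach_trans (IHg _ _ _ gw) _; apply/reach_step/IHf.
- rewrite /pf_prec -/(unpair1 n) -/(unpair2 n).
  rewrite -[in Eval _ n](unpairK n); move: (unpair1 n) (unpair2 n) => a k.
  elim: k v K => [|k IH] v K /=.
    by move=> fv; apply/reach_step; rewrite /= !npairK; apply: IHf.
  move=> [w rw gv]; apply/reach_step; rewrite /= !npairK.
  apply: reach_trans (IH _ _ rw) _; apply/reach_step.
  by rewrite /= !npairK; apply: IHg.
- move=> [fv fk]; apply/reach_step => /=.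
  (* Induction on the distance [d] from the candidate [k] to the result [v]. *)
  suff : forall d k, v = k + d ->
      reach X (Eval f (npair n k) (FMu f (npair n k) :: K)) (Ret v K).
    by apply; rewrite add0n.
  elim=> [|d IH] k vk.
    move: fv; rewrite vk addn0 => /IHf f0; apply: reach_trans (f0 _) _.
    by apply/reach_step; rewrite /= npairK; apply: reach_refl.
  have [|w /IHf fw] := fk k; first by lia.
  apply: reach_trans (fw _) _; apply/reach_step; rewrite /= !npairK.
  by apply: IH; lia.
Qed.

(** What the machine will finally output, described without reference to time:
    [returns X K w v] says that handing [w] to the stack [K] leads to [v]. *)
Fixpoint returns (X : set nat) (K : seq frame) (w v : nat) : Prop :=
  match K with
  | [::] => v = w
  | FPair1 g n :: K => exists2 y, eval X g n y & returns X K (npair w y) v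
  | FPair2 x :: K => returns X K (npair x w) v
  | FComp f :: K => exists2 y, eval X f w y & returns X K y v
  | FRec g p :: K =>
    exists2 y, eval X g (npair (unpair1 p) (npair (unpair2 p) w)) y
             & returns X K y v
  | FMu f p :: K =>
    exists2 k, returns X K k v &
      if w is 0 then k = unpair2 p
      else [/\ eval X f (npair (unpair1 p) k) 0, unpair2 p < k &
             forall i, unpair2 p < i < k ->
               exists w', eval X f (npair (unpair1 p) i) w'.+1]
  end.

Definition denotes (X : set nat) (s : config) (v : nat) : Prop :=
  match s with
  | Eval c n K => exists2 w, eval X c n w & returns X K w v
  | Ret w K => returns X K w v
  end.

(** The denotation goes backwards along a run: a final configuration denotes its
    own output, hence so does the start, which is soundness of the machine. *)
Lemma denotes_step X s v : denotes X (step X s) v -> denotes X s v.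
Proof.
case: s => [[|||||f g|f g|f g|f] n K|w [|[g n|x|f|g p|f p] K]] //=;
  try by move=> Kv; eexists; last exact: Kv.
- move=> [x fx [y gy Kv]]; exists (npair x y) => //.
  by exists x, y.
- by move=> [w gw [y fy Kv]]; exists y => //; exists w.
- rewrite /pf_prec -/(unpair1 n) -/(unpair2 n).
  case: (unpair2 n) => [|j] //= [w rw [y gy Kv]].
  exists y => //; move: rw gy; rewrite /pf_prec.
  rewrite -/(unpair1 (npair _ _)) -/(unpair2 (npair _ _)) !npairK => rw gy.
  by exists w.
- move=> [w fw [k Kv]]; rewrite !npairK; case: w fw => [|w] fw.
    by move=> k0; exists k => //; split; rewrite k0 //.
  move=> [fk k0 fi]; exists k => //; split=> // -[_|i ik]; first by exists w.
  exact: fi.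
- case: w => [|w] /=; first by exists (unpair2 p).
  move=> [y fy [k Kv]]; rewrite !npairK; case: y fy => [|y] fy.
    by move=> kE; exists k => //; split; rewrite kE //; lia.
  move=> [fk k0 fi]; exists k => //; split=> //; first exact: ltnW.
  move=> i /andP[]; rewrite leq_eqVlt => /orP[/eqP <- _|pi ik]; first by exists y.
  by apply: fi; rewrite pi.
Qed.

(** All frames have the shape tag, program, number, so that [ret_step] can
    take them apart before it looks at the tag. *)
Definition encode_frame (F : frame) : nat :=
  match F with
  | FPair1 g n => npair 0 (npair (encode g) n)
  | FPair2 x => npair 1 (npair 0 x)
  | FComp f => npair 2 (npair (encode f) 0)
  | FRec g p => npair 3 (npair (encode g) p)
  | FMu f p => npair 4 (npair (encode f) p)
  end.

Definition push (i e x K : nat) : nat := (npair (npair i (npair e x)) K).+1.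

Fixpoint encode_stack (K : seq frame) : nat :=
  if K is F :: K then (npair (encode_frame F) (encode_stack K)).+1 else 0.

Definition eval_config (e n K : nat) : nat := npair 0 (npair e (npair n K)).

Definition ret_config (v K : nat) : nat := npair 1 (npair v K).

Definition encode_config (s : config) : nat :=
  match s with
  | Eval c n K => eval_config (encode c) n (encode_stack K)
  | Ret v K => ret_config v (encode_stack K)
  end.

(** The composite codes are the numbers [4 * q + 5 + i] with [i < 4], where [i]
    tells the constructor and [q] holds the components. *)
Definition eval_step (X : set nat) (e n K : nat) : nat :=
  let q := (e - 5) %/ 4 in
  let f := unpair1 q in
  let g := unpair2 q in
  if e == 0 then ret_config 0 K
  else if e == 1 then ret_config n.+1 K
  else if e == 2 then ret_config (unpair1 n) K
  else if e == 3 then ret_config (unpair2 n) K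
  else if e == 4 then ret_config (charfun X n) K
  else if (e - 5) %% 4 == 0 then eval_config f n (push 0 g n K)
  else if (e - 5) %% 4 == 1 then eval_config g n (push 2 f 0 K)
  else if (e - 5) %% 4 == 2 then
    if unpair2 n == 0 then eval_config f (unpair1 n) K
    else let p := npair (unpair1 n) (unpair2 n).-1 in
         eval_config e p (push 3 g p K)
  else eval_config q (npair n 0) (push 4 q (npair n 0) K).

Definition ret_step (v K : nat) : nat :=
  let i := unpair1 (unpair1 K.-1) in
  let f := unpair1 (unpair2 (unpair1 K.-1)) in
  let p := unpair2 (unpair2 (unpair1 K.-1)) in
  let K' := unpair2 K.-1 in
  if K == 0 then ret_config v K
  else if i == 0 then eval_config f p (push 1 0 v K')
  else if i == 1 then ret_config (npair p v) K'
  else if i == 2 then eval_config f v K'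
  else if i == 3 then eval_config f (npair (unpair1 p) (npair (unpair2 p) v)) K'
  else if v == 0 then ret_config (unpair2 p) K'
  else let p' := npair (unpair1 p) (unpair2 p).+1 in
       eval_config f p' (push 4 f p' K').

Definition nat_step (X : set nat) (s : nat) : nat :=
  let d := unpair2 s in
  if unpair1 s == 0
  then eval_step X (unpair1 d) (unpair1 (unpair2 d)) (unpair2 (unpair2 d))
  else ret_step (unpair1 d) (unpair2 d).

Lemma eval_stepE X c n K :
  eval_step X (encode c) n (encode_stack K) = encode_config (step X (Eval c n K)).
Proof.
have node i m : i < 4 -> [/\ 4 * m + (5 + i) - 5 = 4 * m + i,
    (4 * m + i) %/ 4 = m & (4 * m + i) %% 4 = i] by move=> i4; split; lia.
have big i m : 4 * m + (5 + i) = (4 * m + i).+1.+4 by lia.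
case: c => [|||||f g|f g|f g|f] //; rewrite /eval_step [encode _]/=.
- have [] := node 0 (npair (encode f) (encode g)) isT; rewrite [5 + 0]/= => -> -> ->.
  by rewrite (big 0) !npairK.
- have [] := node 1 (npair (encode f) (encode g)) isT; rewrite [5 + 1]/= => -> -> ->.
  by rewrite (big 1) !npairK.
- have [] := node 2 (npair (encode f) (encode g)) isT; rewrite [5 + 2]/= => -> -> ->.
  by rewrite !npairK (big 2) /=; case: (unpair2 n) => //= k; rewrite (big 2).
- have [] := node 3 (encode f) isT; rewrite [5 + 3]/= => -> -> ->.
  by rewrite (big 3).
Qed.

Lemma ret_stepE X v K :
  ret_step v (encode_stack K) = encode_config (step X (Ret v K)).
Proof.
case: K => [|[g n|x|f|g p|f p] K] //; rewrite /ret_step /= !npairK //=.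
by case: v.
Qed.

Lemma nat_stepE X s : nat_step X (encode_config s) = encode_config (step X s).
Proof.
case: s => [c n K|v K]; rewrite /nat_step !npairK /=.
  exact: eval_stepE.
exact: ret_stepE.
Qed.

Lemma computable_nat_step X s :
  computable_in X s -> computable_in X (fun n => nat_step X (s n)).
Proof.
move=> hs; rewrite /nat_step /eval_step /ret_step /eval_config /ret_config /push.
computable; (apply: computable_div4 || apply: computable_mod4); computable.
Qed.

(** Zero stands for a run that has not finished, [v.+1] for the result [v]. *)
Definition output (s : nat) : nat :=
  if unpair1 s == 0 then 0
  else if unpair2 (unpair2 s) == 0 then (unpair1 (unpair2 s)).+1 else 0.

Lemma output_config s v : output (encode_config s) = v.+1 -> s = Ret v [::].
Proof. by case: s => [c n K|w [|F K]]; rewrite /output !npairK //= => -[->]. Qed.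

Definition run (X : set nat) (e n t : nat) : nat :=
  output (iter t (nat_step X) (eval_config e n 0)).

Lemma run_encode X c n t :
  run X (encode c) n t = output (encode_config (iter t (step X) (Eval c n [::]))).
Proof.
congr output; elim: t => [|t IH] //.
by rewrite !iterS IH nat_stepE.
Qed.

Lemma run_sound X e n t v : run X e n t = v.+1 -> Phi X e n v.
Proof.
have [c <-] := encode_surj e; rewrite run_encode => /output_config runv.
apply/Phi_encode.
suff : denotes X (Eval c n [::]) v by case=> w cw ->.
have : denotes X (iter t (step X) (Eval c n [::])) v by rewrite runv.
elim: t {runv} => [|t IH] //; rewrite iterS => /denotes_step; exact: IH.
Qed.

(** The machine stays in a final configuration, so a result is eventually
    permanent. *)
Lemma run_complete X e n v :
  Phi X e n v -> \forall t \near \oo, run X e n t = v.+1.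
Proof.
have [c <-] := encode_surj e; move=> /Phi_encode/(eval_reach _ _ _ _ [::])[t0 runt0].
exists t0 => // t /= t0t; rewrite run_encode -(subnK t0t) iterD runt0.
have -> : iter (t - t0) (step X) (Ret v [::]) = Ret v [::].
  by elim: (t - t0) => //= k ->.
by rewrite /output !npairK.
Qed.

Lemma computable_run X e n t :
  computable_in X e -> computable_in X n -> computable_in X t ->
  computable_in X (fun x => run X (e x) (n x) (t x)).
Proof.
move=> he hn ht; rewrite /run /output /eval_config.
have hstep := computable_nat_step X id (computable_id X).
have hiter : computable_in X
  (fun x => iter (t x) (nat_step X) (npair 0 (npair (e x) (npair (n x) 0)))).
  apply: (computable_iter X _ (fun=> nat_step X)) => //; computable.
computable.
Qed.

(** * The limit lemma *)

(** A search below a moving bound [t]: the iteration stops by itself at the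
    first zero. *)
Lemma iter_search (g : nat -> nat) v t :
  g v = 0 -> (forall k, k < v -> g k != 0) ->
  iter t (fun k => if g k == 0 then k else k.+1) 0 = minn t v.
Proof.
move=> gv gk; elim: t => [|t IH]; first by rewrite min0n.
rewrite iterS IH; case: (ltnP t v) => tv.
  by rewrite (negbTE (gk _ tv)); lia.
by rewrite gv eqxx; lia.
Qed.

(** Induction on the program. The stage-[t] approximation evaluates the program
    with the oracle replaced by the set of programs that have halted within [t]
    steps, and with searches cut off at [t]. A terminating evaluation makes
    finitely many subevaluations, each of which is eventually correct. Elsewhere
    the values of [h] are arbitrary, so that [h] can be total. *)
Lemma eval_jump_limit X c :
  exists2 h, computable2_in X h &
    forall n v, eval (jump X) c n v -> \forall t \near \oo, h n t = v.
Proof.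
elim: c => [|||||f [hf cf lf] g [hg cg lg]|f [hf cf lf] g [hg cg lg]
           |f [hf cf lf] g [hg cg lg]|f [hf cf lf]] /=.
- by exists (fun _ _ => 0); [computable|move=> n v ->; exists 0].
- by exists (fun n _ => n.+1); [computable|move=> n v ->; exists 0].
- by exists (fun n _ => unpair1 n); [computable|move=> n v ->; exists 0].
- by exists (fun n _ => unpair2 n); [computable|move=> n v ->; exists 0].
- exists (fun n t => if run X n n t == 0 then 0 else 1).
    computable.
    by apply: (computable_run X (fun p => unpair1 p) (fun p => unpair1 p)
      (fun p => unpair2 p)); computable.
  move=> n v ->; rewrite /charfun.
  case: (boolP (n \in jump X)) => [/set_mem[w /run_complete]|nX].
    by apply: filterS => t ->.
  exists 0 => // t _; case E : (run X n n t) => [|w] //.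
  move/run_sound: E => nw; case/negP: nX; apply/mem_set.
  by exists w.
- exists (fun n t => npair (hf n t) (hg n t)); first by computable.
  move=> n v [x [y [/lf fx /lg gy ->]]].
  by apply: filterS2 fx gy => t -> ->.
- exists (fun n t => hf (hg n t) t); first by computable.
  move=> n v [w /lg gw /lf fv].
  by apply: filterS2 gw fv => t -> ->.
- exists (fun n t => iteri (unpair2 n)
    (fun j w => hg (npair (unpair1 n) (npair j w)) t) (hf (unpair1 n) t)).
    by computable.
  move=> n v; rewrite /pf_prec -/(unpair1 n) -/(unpair2 n).
  elim: (unpair2 n) v => [|k IH] v /=; first exact: lf.
  move=> [w /IH rw /lg gv].
  by apply: filterS2 rw gv => t -> ->.
- exists (fun n t => iter t (fun k => if hf (npair n k) t == 0 then k else k.+1) 0).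
    by computable.
  move=> n v [/lf f0 fk].
  have fk' : \forall t \near \oo, forall k : 'I_v, hf (npair n k) t != 0.
    apply: filter_forall => k; have [w /lf] := fk k (ltn_ord k).
    by apply: filterS => t ->.
  have vt : \forall t \near \oo, v <= t by exists v.
  apply: filterS3 f0 fk' vt => t f0 fk' vt.
  rewrite (iter_search (fun k => hf (npair n k) t) v) //; first exact/minn_idPr.
  by move=> k kv; apply: (fk' (Ordinal kv)).
Qed.

Lemma limit_lemma X f :
  computable_in (jump X) f ->
  exists2 h, computable2_in X h & forall n, \forall t \near \oo, h n t = f n.
Proof.
move=> /computable_inP[c cf]; have [h hh hlim] := eval_jump_limit X c.
by exists h => // n; apply: hlim; apply/cf.
Qed.

(** * Computable pseudointersections *)

Lemma computable_has X p k :
  computable2_in X p -> computable_in X k ->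
  computable_in X (fun n => has (fun i => p n i != 0) (iota 0 (k n)) : nat).
Proof.
move=> hp hk.
suff hasE n : has (fun i => p n i != 0) (iota 0 (k n)) =
    iteri (k n) (fun i w => if p n i == 0 then w else 1) 0 :> nat.
  by under eq_fun do rewrite hasE; computable.
elim: (k n) => [|j IH] //.
by rewrite -addn1 iotaD has_cat /= orbF addn1 /= -IH; case: eqP; rewrite ?orbT ?orbF.
Qed.

Lemma infinite_range (x : nat -> nat) :
  (forall s, x s < x s.+1) -> infinite_set (range x).
Proof.
move=> xlt finx; apply: infinite_nat; rewrite -(preimage_range x).
have xhomo : {homo x : i j / i < j} by apply: homo_ltn xlt; apply: ltn_trans.
apply: finite_preimage finx => i j _ _; exact: incn_inj (leq_mono xhomo) _ _.
Qed.

(** Strict monotonicity gives [i <= x i], so membership of [u] is decided by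
    the entries up to index [u]. *)
Lemma computable_range x :
  computable_in set0 x -> (forall s, x s < x s.+1) -> computable_set (range x).
Proof.
move=> hx xlt.
have xge s : s <= x s by elim: s => // s IH; apply: leq_ltn_trans IH (xlt s).
pose hit (u i : nat) := if x i == u then 1 else 0.
suff charE u : charfun (range x) u = has (fun i => hit u i != 0) (iota 0 u.+1).
  suff : computable_in set0 (charfun (range x)) by [].
  rewrite (funext charE); apply: computable_has; rewrite /hit; computable.
rewrite /charfun; congr nat_of_bool; apply/idP/hasP => [/set_mem[i _ xi]|[i _]].
  by exists i; rewrite /hit ?mem_iota -?xi ?eqxx //= ltnS.
by rewrite /hit; case: (x i =P u) => // xi _; apply/mem_set; exists i.
Qed.

Lemma infinite_gt (A : set nat) k : infinite_set A -> exists2 x, A x & k < x.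
Proof.
move=> infA; apply: contrapT => nA; apply: infA.
apply: (sub_finite_set _ (finite_II k.+1)) => x Ax /=.
by rewrite ltnNge; apply/negP => kx; apply: nA; exists x.
Qed.

(** Elements are picked by searching over numbers and stages together. Demanding
    a stage at least [s] in round [s] makes each guess [h n t] correct in all but
    finitely many rounds, while the search never has to know whether it is. *)
Lemma computable_pseudointersection (A : nat -> set nat) (r : nat -> nat) :
  computable_in (jump set0) r -> (forall n, char_index (r n) (A n)) ->
  (forall n, infinite_set [set x | forall i, i <= n -> A i x]) ->
  exists R : set nat, [/\ infinite_set R, computable_set R &
    forall n, finite_set (R `\` A n)].
Proof.
move=> /limit_lemma[h hh hlim] rA Ainf.
have runA i x : A i x -> \forall t \near \oo, run set0 (h i t) x t = 2.
  move=> Aix; have : phi (r i) x 1 by apply/rA; rewrite /charfun mem_set.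
  by move=> /run_complete; apply: filterS2 (hlim i) => t ->.
(* A candidate [k] packs a number and a stage; [p] packs the round [s] and the
   previously chosen number. *)
pose fails k i :=
  if run set0 (h i (unpair2 k)) (unpair1 k) (unpair2 k) == 2 then 0 else 1.
pose miss p k :=
  (unpair2 p).+1 - unpair1 k + (unpair1 p - unpair2 k)
  + has (fun i => fails k i != 0) (iota 0 (unpair1 p).+1).
have missP s l x t : miss (npair s l) (npair x t) = 0 <->
    [/\ l < x, s <= t & forall i, i <= s -> run set0 (h i t) x t = 2].
  rewrite /miss !npairK; case: hasP => [[i]|nfail].
    rewrite mem_iota /fails !npairK add0n ltnS /= => si nrun.
    by split=> [|[_ _ /(_ i si) run2]]; [lia|rewrite run2 in nrun].
  split=> [m0|[lx st _]]; last by lia.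
  split; [lia|lia|move=> i si; apply: contrapT => nrun; apply: nfail].
  exists i; first by rewrite mem_iota add0n.
  by rewrite /fails !npairK; case: (run _ _ _ _ =P 2).
have hfails : computable2_in set0 fails.
  rewrite /fails; computable.
  apply: (computable_run set0 (fun p => h (unpair2 p) (unpair2 (unpair1 p)))
    (fun p => unpair1 (unpair1 p)) (fun p => unpair2 (unpair1 p))); computable.
have [m hm m0] : exists2 m, computable_in set0 m & forall p, miss p (m p) = 0.
  apply: computable_search => [|p].
    rewrite /miss; computable.
    apply: (computable_has set0 (fun p => fails (unpair2 p))
      (fun p => (unpair1 (unpair1 p)).+1)); computable.
  rewrite -(unpairK p); move: (unpair1 p) (unpair2 p) => s l.
  have [x Ax lx] := infinite_gt _ l (Ainf s).
  have runs : \forall t \near \oo,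
      forall i : 'I_s.+1, run set0 (h i t) x t = 2.
    by apply: filter_forall => i; apply/runA/Ax; rewrite -ltnS.
  have st : \forall t \near \oo, s <= t by exists s.
  have [t [runt {}st]] := filter_ex (filterI runs st).
  exists (npair x t); apply/missP; split=> // i si.
  by apply: (runt (Ordinal (_ : i < s.+1))).
(* [y s.+1] is the number chosen in round [s]; the dummy [y 0] starts the chain. *)
pose y s := iteri s (fun j l => unpair1 (m (npair j l))) 0.
pose t s := unpair2 (m (npair s (y s))).
have yP s : [/\ y s < y s.+1, s <= t s &
    forall i, i <= s -> run set0 (h i (t s)) (y s.+1) (t s) = 2].
  by apply/missP; rewrite /y /t /= unpairK m0.
have hy : computable_in set0 (fun s => y s.+1) by rewrite /y; computable.
have ylt s : y s.+1 < y s.+2 by have [] := yP s.+1.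
exists (range (fun s => y s.+1)); split.
- exact: infinite_range.
- exact: computable_range.
(* Only the numbers chosen before round [maxn N n] can lie outside [A n]. *)
move=> n; have [N _ hN] := hlim n.
apply: (sub_finite_set _ (finite_image (fun s => y s.+1) (finite_II (maxn N n)))).
move=> _ [[s _ <-] nA]; exists s => //=; rewrite ltnNge geq_max.
apply/negP => /andP[Ns ns]; apply: nA.
have [_ st /(_ n ns)] := yP s; rewrite hN /=; last exact: leq_trans Ns st.
move=> /run_sound/rA; rewrite /charfun.
by case: (boolP (_ \in _)) => // /set_mem.
Qed.

(** The inclusions of a tower hold only up to finite sets, but finitely many of
    them are used: almost all of the infinite level [n] lies in all earlier
    levels. *)
Lemma tower_infinite_meet (G : set nat) n :
  tower G -> infinite_set [set x | forall i, i <= n -> column G i x].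
Proof.
move=> [_ _ GS].
have tail k : finite_set
    (column G k `\` [set x | forall i, i <= k -> column G i x]).
  elim: k => [|k IH].
    apply: (sub_finite_set _ (finite_set0 _)) => x [G0x []] i.
    by rewrite leqn0 => /eqP->.
  have [Gk _] := GS k.
  have : finite_set ((column G k.+1 `\` column G k) `|`
      (column G k `\` [set x | forall i, i <= k -> column G i x])).
    by rewrite finite_setU.
  apply: sub_finite_set => x [Gx nGx].
  have [Gkx|] := pselect (column G k x); last by left.
  right; split=> // Gi; apply: nGx => i.
  by rewrite leq_eqVlt => /orP[/eqP->|/Gi].
move=> fin; have [_] := GS n; apply.
have : finite_set ([set x | forall i, i <= n -> column G i x] `|`
    (column G n `\` [set x | forall i, i <= n -> column G i x])).
  by rewrite finite_setU.
apply: sub_finite_set => x [Gx _].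
by have [|] := pselect (forall i, i <= n -> column G i x); [left|right].
Qed.

Theorem proposition2p4 (G : set nat) (hG : maximal_tower G) :
  ~ exists r : nat -> nat,
      computable_in (jump set0) r /\
      forall n : nat, char_index (r n) (column G n).
Proof.
move=> [r [hr rG]]; have [towerG maxG] := hG.
have [R [infR compR finR]] := computable_pseudointersection _ _ hr rG
  (fun n => tower_infinite_meet G n towerG).
by have [n] := maxG R infR compR; apply; apply: finR.
Qed.
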